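(* Let $n\ge 1$ and $r\ge 2$ be integers. Then $\dim C_r(\mathfrak{gl}_n)\ge (r+1)\dim\mathfrak{u}_P+r$.
   Context: $k$ is an algebraically closed field, $\mathfrak{gl}_n$ is the space of $n\times n$ matrices over $k$, and $C_r(\mathfrak{gl}_n)=\{(v_1,\ldots,v_r)\in(\mathfrak{gl}_n)^r : [v_i,v_j]=0 \text{ for all } i,j\}$. $P$ is the parabolic subgroup of $GL_n(k)$ corresponding to the partition $[m,m]$ if $n=2m$, or $[m+1,m]$ if $n=2m+1$, and $\mathfrak{u}_P$ is the Lie algebra of its unipotent radical: explicitly, the space of all block matrices $\begin{pmatrix} 0 & 0 \\ A & 0 \end{pmatrix}$ where $A$ is an arbitrary $m\times m$ matrix if $n=2m$, or an arbitrary $m\times(m+1)$ matrix if $n=2m+1$. Thus $\dim\mathfrak{u}_P=m^2$ if $n=2m$ and $\dim\mathfrak{u}_P=m(m+1)$ if $n=2m+1$. *)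

(* Defs.v *)
From HB Require Import structures.
From mathcomp Require Import all_boot all_order all_algebra.
From mathcomp Require Import boolp classical_sets constructive_ereal.
(* The parsing rules of mpoly are incompatible with those of classical_sets,
   hence its notations are left out: [mpoly N k] is {mpoly k[N]} and
   [meval x p] is p.@[x]. *)
From mathcomp Require mpoly.
Import -(notations) mpoly.

Set Implicit Arguments.
Unset Strict Implicit.
Unset Printing Implicit Defensive.

Import Order.TTheory GRing.Theory Num.Theory.
Local Open Scope classical_set_scope.
Local Open Scope ring_scope.

Section Zariski.
Variables (k : fieldType) (V : vectType k).
Implicit Types (X Z W : set V) (C : nat -> set V).

(* The basis is immaterial: a linear change of coordinates maps polynomials
   to polynomials. *)
Definition peval (p : mpoly (\dim {:V}) k) (v : V) : k :=
  meval (fun i => coord (vbasis {:V}) i v) p.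

Definition zariski_closed Z : Prop :=
  exists S : set (mpoly (\dim {:V}) k),
    Z = [set v | forall p, S p -> peval p v = 0].

(* Closed for the topology induced on X by the Zariski topology of V. *)
Definition zariski_closed_in X Z : Prop :=
  exists2 W, zariski_closed W & Z = X `&` W.

Definition zariski_irreducible Z : Prop :=
  Z !=set0 /\
  forall W1 W2, zariski_closed W1 -> zariski_closed W2 ->
    Z `<=` W1 `|` W2 -> Z `<=` W1 \/ Z `<=` W2.

(* C 0 < C 1 < ... < C l : l strict inclusions, l.+1 terms. *)
Definition irreducible_chain X (l : nat) C : Prop :=
  (forall i, (i <= l)%N ->
     zariski_closed_in X (C i) /\ zariski_irreducible (C i)) /\
  (forall i, (i < l)%N -> C i `<` C i.+1).

(* Krull dimension, in the integers extended with -oo and +oo: the dimension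
   is -oo for the empty set and +oo if there are arbitrarily long chains.
   The least upper bound always exists, see [le_zariski_dim]. *)
Definition zariski_dim X : \bar int :=
  supremum -oo%E
    [set (l%:Z)%:E | l in [set l : nat | exists C, irreducible_chain X l C]].

Lemma irreducible_chain_leq X l d C :
  (d <= l)%N -> irreducible_chain X l C -> irreducible_chain X d C.
Proof.
move=> dl [irrC ltC]; split=> i id.
  by apply: irrC; apply: leq_trans dl.
by apply: ltC; apply: leq_trans dl.
Qed.

Lemma le_zariski_dim X (d : nat) :
  ((d%:Z)%:E <= zariski_dim X)%E <-> exists C, irreducible_chain X d C.
Proof.
rewrite /zariski_dim.
set A := (X in supremum _ X); pose L l := exists C, irreducible_chain X l C.
have [supA|noA] := pselect (exists x, supremums A x); last first.
  exfalso; apply: noA.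
  have [[l Ll]|L0] := pselect (exists l, L l); last first.
    exists -oo%E; split=> [x [l Ll _]|y _]; last exact: leNye.
    by case: L0; exists l.
  have [bL|ubL] := pselect (exists b, forall m, L m -> (m <= b)%N).
    case: bL => b bL.
    have exL : exists m, `[< L m >] by exists l; apply/asboolP.
    have leL m : `[< L m >] -> (m <= b)%N by move/asboolP/bL.
    case: (ex_maxnP exL leL) => m /asboolP Lm maxm.
    exists (m%:Z)%:E; split=> [_ [j Lj <-]|y uby]; last by apply: uby; exists m.
    by rewrite lee_fin lez_nat maxm//; apply/asboolP.
  exists +oo%E; split=> [_ [j Lj <-]|y uby]; first exact: leey.
  case: y uby => [b| |] uby //; last first.
    by have := uby _ (ex_intro2 _ _ l Ll erefl).
  case: ubL; exists `|b|%N => m Lm.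
  have := uby _ (ex_intro2 _ _ m Lm erefl).
  rewrite lee_fin => mb; rewrite -lez_nat.
  by apply: (le_trans mb); rewrite abszE ler_norm.
have xP : A !=set0 -> supremums A (supremum -oo%E A).
  move=> A0; rewrite /supremum ifF; last by apply/negbTE/set0P.
  exact: xgetPex.
split=> [dX|Ld]; last first.
  have Ad : A (d%:Z)%:E by exists d.
  by have [+ _] := xP (ex_intro _ _ Ad); apply.
have [A0|/set0P A0] := eqVneq A set0.
  by move: dX; rewrite A0 /supremum eqxx.
have [_ lbX] := xP A0.
apply: contrapT => Nd.
have ubd : ubound A ((d%:Z - 1)%:E).
  move=> _ [l [C chC] <-]; rewrite lee_fin.
  have ld : (l < d)%N.
    by rewrite ltnNge; apply/negP => /irreducible_chain_leq/(_ chC) H;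
      apply: Nd; exists C.
  by rewrite lerBrDr -PoszD lez_nat addn1.
have := le_trans dX (lbX _ ubd).
by rewrite lee_fin lerBrDr -PoszD lez_nat addn1 ltnn.
Qed.

End Zariski.

Definition lie_bracket (k : fieldType) (n : nat) (x y : 'M[k]_n) : 'M[k]_n :=
  x *m y - y *m x.

Definition commuting_variety (k : fieldType) (n r : nat) :
    set {ffun 'I_r -> 'M[k]_n} :=
  [set v | forall i j, lie_bracket (v i) (v j) = 0].
Arguments commuting_variety k n r : clear implicits.

Lemma uphalf_addn_half (n : nat) : (uphalf n + n./2)%N = n.
Proof. by rewrite uphalf_half -addnA addnn odd_double_half. Qed.

(* The parabolic has blocks of size [uphalf n; n./2], which is [m; m] for
   n = 2m and [m + 1; m] for n = 2m + 1. *)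
Definition uP_block (k : fieldType) (n : nat)
    (A : 'M[k]_(n./2, uphalf n)) : 'M[k]_n :=
  castmx (uphalf_addn_half n, uphalf_addn_half n) (block_mx 0 0 A 0).

Definition uP (k : fieldType) (n : nat) : {vspace 'M[k]_n} :=
  limg (linfun (@uP_block k n)).

Section uPTheory.
Variables (k : fieldType) (n : nat).

Lemma uP_block_is_linear : linear (@uP_block k n).
Proof.
move=> a A B; rewrite /uP_block.
have -> : block_mx 0 0 (a *: A + B) 0 =
    a *: block_mx 0 0 A 0 + block_mx 0 0 B 0 :> 'M[k]_(uphalf n + n./2).
  by rewrite scale_block_mx add_block_mx !scaler0 !addr0.
by apply/matrixP => i j; rewrite !(mxE, castmxE).
Qed.

HB.instance Definition _ :=
  GRing.isLinear.Build k _ _ _ (@uP_block k n) uP_block_is_linear.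

Lemma mem_uP (M : 'M[k]_n) : M \in uP k n <-> exists A, M = uP_block A.
Proof.
split=> [/memv_imgP[A _ ->]|[A ->]]; first by exists A; rewrite lfunE.
by rewrite -[uP_block A](lfunE (@uP_block k n)) memv_img ?memvf.
Qed.

Lemma dim_uP : \dim (uP k n) = (n./2 * uphalf n)%N.
Proof.
rewrite limg_dim_eq ?dimvf //.
apply/eqP; rewrite -subv0; apply/subvP => A; rewrite memv_cap memvf /=.
rewrite memv_ker lfunE /= memv0 => /eqP A0; apply/eqP.
have : castmx (esym (uphalf_addn_half n), esym (uphalf_addn_half n))
         (uP_block A) = 0 by rewrite A0; apply/matrixP=> i j; rewrite castmxE !mxE.
by rewrite /uP_block castmxK -block_mx0 => /eq_block_mx[].
Qed.

End uPTheory.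

(* Main.v *)
Require Import Defs.
From HB Require Import structures.
From mathcomp Require Import all_boot all_order all_algebra.
From mathcomp Require Import boolp classical_sets constructive_ereal.
From mathcomp Require mpoly.
Import -(notations) mpoly.

(** Conjugating [[0, 0], [A_l, 0]] by [[1, B], [0, 1]] and adding scalars c_l
    gives commuting tuples depending polynomially on (B, A, c), that is on
    (r + 1) dim u_P + r parameters. Freeing these parameters one at a time, from
    the base point A_0 = (1 0), everything else 0, gives images of affine
    spaces, whose closures are irreducible. They increase strictly: while A and
    c are at the base point, the upper left block of the 0-th matrix is (B 0);
    the lower left block of the l-th matrix is always A_l; and its square
    vanishes as soon as c_l = 0. *)

Set Implicit Arguments.
Unset Strict Implicit.
Unset Printing Implicit Defensive.

Import GRing.Theory.
Local Open Scope classical_set_scope.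
Local Open Scope ring_scope.

(** * Polynomial functions, polynomial curves and Zariski closures *)

Section PolynomialMaps.
Variables (k : fieldType) (V : vectType k).
Implicit Types (f g : V -> k) (c : k -> V) (v : V) (W Y Z : set V).

Definition polynomial_function f : Prop :=
  exists p, forall v, peval p v = f v.

Definition polynomial_curve c : Prop :=
  forall i, exists p : {poly k}, forall s, coord (vbasis {:V}) i (c s) = p.[s].

Lemma polynomial_function_cst a : polynomial_function (fun=> a).
Proof. by exists (mpolyC _ a) => v; rewrite /peval mevalC. Qed.

Lemma polynomial_functionD f g : polynomial_function f ->
  polynomial_function g -> polynomial_function (fun v => f v + g v).
Proof.
move=> [p pf] [q qg]; exists (p + q) => v.
by rewrite -pf -qg /peval mevalD.
Qed.

Lemma polynomial_functionM f g : polynomial_function f ->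
  polynomial_function g -> polynomial_function (fun v => f v * g v).
Proof.
move=> [p pf] [q qg]; exists (p * q) => v.
by rewrite -pf -qg /peval mevalM.
Qed.

Lemma polynomial_function_sum (I : Type) (s : seq I) (F : I -> V -> k) :
  (forall i, polynomial_function (F i)) ->
  polynomial_function (fun v => \sum_(i <- s) F i v).
Proof.
move=> polF; elim: s => [|i s IHs].
  have [p pE] := polynomial_function_cst 0.
  by exists p => v; rewrite big_nil.
have [p pE] := polynomial_functionD (polF i) IHs.
by exists p => v; rewrite big_cons pE.
Qed.

Lemma polynomial_function_linear (f : {scalar V}) :
  polynomial_function f.
Proof.
have [p pE] : polynomial_function (fun v => \sum_(i < \dim {:V})
    coord (vbasis {:V}) i v * f (vbasis {:V})`_i).
  apply: polynomial_function_sum => i; apply: polynomial_functionM.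
    by exists (mpolyX k (mnm1 i)) => v; rewrite /peval mevalXU.
  exact: polynomial_function_cst.
exists p => v; rewrite pE [in RHS](coord_vbasis (memvf v)) linear_sum.
by apply: eq_bigr => i _; rewrite linearZ.
Qed.

Lemma peval_curve c p : polynomial_curve c ->
  exists q : {poly k}, forall s, peval p (c s) = q.[s].
Proof.
move=> /(_ _)/cid-/all_tag[q qE].
(* This is [p] with [q i] substituted for the [i]-th variable. *)
exists (\sum_(m <- msupp p) (mcoeff m p)%:P * \prod_i q i ^+ m i) => s.
rewrite /peval mevalE horner_sum; apply: eq_bigr => m _.
rewrite hornerM hornerC horner_prod; congr (_ * _).
by apply: eq_bigr => i _; rewrite horner_exp qE.
Qed.

Definition zariski_closure Z : set V :=
  [set v | forall p, (forall z, Z z -> peval p z = 0) -> peval p v = 0].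

Lemma zariski_closed_closure Z : zariski_closed (zariski_closure Z).
Proof. by exists [set p | forall z, Z z -> peval p z = 0]. Qed.

Lemma sub_zariski_closure Z : Z `<=` zariski_closure Z.
Proof. by move=> v Zv p; apply. Qed.

Lemma zariski_closureS Y Z :
  Y `<=` Z -> zariski_closure Y `<=` zariski_closure Z.
Proof. by move=> YZ v Yv p pZ; apply: Yv => z /YZ/pZ. Qed.

Lemma zariski_closure_min Z W :
  zariski_closed W -> Z `<=` W -> zariski_closure Z `<=` W.
Proof. by move=> [S ->] ZW v Zv p Sp; apply: Zv => z /ZW; apply. Qed.

Lemma zariski_closure_eq0 Z f v : polynomial_function f ->
  (forall z, Z z -> f z = 0) -> zariski_closure Z v -> f v = 0.
Proof. by move=> [p pf] fZ Zv; rewrite -pf; apply: Zv => z /fZ; rewrite pf. Qed.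

(** A closed set that contains [Z] contains its closure, hence also [Y]. *)
Lemma zariski_irreducible_between Y Z : zariski_irreducible Z ->
  Z `<=` Y -> Y `<=` zariski_closure Z -> zariski_irreducible Y.
Proof.
move=> [[z Zz] irrZ] ZY YZ; split; first by exists z; apply: ZY.
move=> W1 W2 W1c W2c YW.
have [ZW|ZW] := irrZ W1 W2 W1c W2c (subset_trans ZY YW).
  by left; apply: (subset_trans YZ); apply: zariski_closure_min.
by right; apply: (subset_trans YZ); apply: zariski_closure_min.
Qed.

Lemma zariski_closedN W v : zariski_closed W -> ~ W v ->
  exists2 p, (forall w, W w -> peval p w = 0) & peval p v != 0.
Proof.
move=> [S ->] /existsNP[p /not_implyP[Sp /eqP pv]].
by exists p => // w; apply.
Qed.

End PolynomialMaps.

(** * Lower bounds on the dimension from sets joined by polynomial curves *)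

Section ChainsOfCurveConnectedSets.
Variables (k : closedFieldType) (V : vectType k).
Implicit Types (X Z : set V).

(** A single curve has to join the two points; images of affine spaces under polynomial maps
    qualify, through the images of lines. *)
Definition curve_connected Z : Prop :=
  forall x y, Z x -> Z y -> exists c : k -> V,
    [/\ polynomial_curve c, forall s, Z (c s), c 0 = x & c 1 = y].

(* If [Z] is contained in neither [W1] nor [W2], take a curve in [Z] from a
   point outside [W1] to a point outside [W2]; all but finitely many of its
   points avoid both. *)
Lemma curve_connected_irreducible Z :
  Z !=set0 -> curve_connected Z -> zariski_irreducible Z.
Proof.
move=> Z0 conZ; split=> // W1 W2 W1c W2c ZW; apply: contrapT.
move=> /not_orP[/existsNP[x /not_implyP[Zx W1x]]].
move=> /existsNP[y /not_implyP[Zy W2y]].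
have [c [pc Zc c0 c1]] := conZ x y Zx Zy.
have [p pW px] := zariski_closedN W1c W1x.
have [q qW qy] := zariski_closedN W2c W2y.
have [P PE] := peval_curve p pc; have [Q QE] := peval_curve q pc.
have P0 : P != 0.
  by apply: contraNneq px => P0; rewrite -c0 PE P0 horner0.
have Q0 : Q != 0.
  by apply: contraNneq qy => Q0; rewrite -c1 QE Q0 horner0.
have /closed_nonrootP[s] : P * Q != 0 by rewrite mulf_neq0.
rewrite rootE hornerM mulf_eq0 -PE -QE => /norP[ps qs].
by have [/pW|/qW] := ZW _ (Zc s); apply/eqP.
Qed.

(** The sets [L i] need not be closed: the chain consists of their closures in [X]. A polynomial
    function that vanishes on [L i] vanishes on its closure, so one point of [L i.+1] where it is
    nonzero makes the inclusion strict. *)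
Lemma le_zariski_dim_curve_connected X (d : nat) (L : nat -> set V) :
  (forall i, (i <= d)%N ->
     [/\ L i !=set0, L i `<=` X & curve_connected (L i)]) ->
  (forall i, (i < d)%N -> L i `<=` L i.+1) ->
  (forall i, (i < d)%N -> exists f : V -> k,
     [/\ polynomial_function f, forall v, L i v -> f v = 0 &
         exists2 v, L i.+1 v & f v != 0]) ->
  ((d%:Z)%:E <= zariski_dim X)%E.
Proof.
move=> Lirr Lsub Lsep; apply/le_zariski_dim.
exists (fun i => X `&` zariski_closure (L i)); split=> i id.
  have [L0 LX Lc] := Lirr i id; split.
    by exists (zariski_closure (L i)) => //; apply: zariski_closed_closure.
  apply: (zariski_irreducible_between (curve_connected_irreducible L0 Lc)).
    by move=> v Lv; split; [apply: LX | apply: sub_zariski_closure].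
  by move=> v [].
split.
  by move=> v [Xv Lv]; split=> //; apply: zariski_closureS Lv; apply: Lsub.
have [f [pf f0 [v Lv /eqP fv]]] := Lsep i id.
have [_ LX _] := Lirr i.+1 id.
move=> /(_ v)[|_ Lcv]; first by split; [apply: LX | apply: sub_zariski_closure].
by apply: fv; apply: zariski_closure_eq0 Lcv.
Qed.

End ChainsOfCurveConnectedSets.

(** * Linear forms and polynomial curves on tuples of matrices *)

Section MatrixTuples.
Variables (k : fieldType) (n r : nat).
Local Notation V := {ffun 'I_r -> 'M[k]_n}.

Definition tuple_entry (l : 'I_r) (i j : 'I_n) (v : V) : k := v l i j.

Lemma tuple_entry_is_linear l i j : scalar (tuple_entry l i j).
Proof. by move=> a u v; rewrite /tuple_entry !ffunE !mxE. Qed.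

HB.instance Definition _ l i j :=
  GRing.isLinear.Build k V k *%R (tuple_entry l i j)
    (tuple_entry_is_linear l i j).

Lemma tuple_sum_delta (v : V) : v = \sum_l \sum_i \sum_j
  v l i j *: [ffun l' => if l' == l then delta_mx i j else 0].
Proof.
apply/ffunP => l; rewrite sum_ffunE (bigD1 l)//= [X in _ + X]big1 ?addr0.
  rewrite {1}[v l]matrix_sum_delta sum_ffunE; apply: eq_bigr => i _.
  by rewrite sum_ffunE; apply: eq_bigr => j _; rewrite !ffunE eqxx.
move=> l' /negPf l'l; rewrite sum_ffunE big1// => i _.
by rewrite sum_ffunE big1// => j _; rewrite !ffunE eq_sym l'l scaler0.
Qed.

(** The coordinates in [vbasis] need not be matrix entries; being linear forms, they are fixed
    linear combinations of the entries. *)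
Lemma polynomial_curve_tuple (P : 'I_r -> 'M[{poly k}]_n) :
  polynomial_curve (fun s => [ffun l => map_mx (horner_eval s) (P l)] : V).
Proof.
move=> m; pose f : {scalar V} := coord (vbasis {:V}) m.
exists (\sum_l \sum_i \sum_j
  P l i j * (f [ffun l' => if l' == l then delta_mx i j else 0])%:P) => s.
rewrite -[LHS]/(f _) [X in f X]tuple_sum_delta linear_sum horner_sum.
apply: eq_bigr => l _; rewrite linear_sum horner_sum.
apply: eq_bigr => i _; rewrite linear_sum horner_sum.
apply: eq_bigr => j _.
by rewrite linearZ hornerM hornerC ffunE mxE /horner_eval.
Qed.

End MatrixTuples.

(** * The commuting matrices attached to the parameters [B], [A_l], [c_l] *)

Section Parametrization.
Variables (q p r : nat).

(** The summands index the entries of [B], those of the [A_l], and the scalars [c_l]. *)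
Definition coordinate : Type :=
  (('I_q * 'I_p) + ('I_r * ('I_p * 'I_q) + 'I_r))%type.

HB.instance Definition _ := Equality.on coordinate.

Section Ring.
Variable R : comNzRingType.
Implicit Type t : coordinate -> R.

Definition parB t : 'M[R]_(q, p) := \matrix_(i, j) t (inl (i, j)).
Definition parA t l : 'M[R]_(p, q) := \matrix_(i, j) t (inr (inl (l, (i, j)))).
Definition parc t l : R := t (inr (inr l)).

(* The conjugate of [block_mx 0 0 A 0] by [block_mx 1 B 0 1]. *)
Definition conj_uP (B : 'M[R]_(q, p)) (A : 'M[R]_(p, q)) : 'M[R]_(q + p) :=
  col_mx B 1%:M *m A *m row_mx 1%:M (- B).

Definition par_mx t l : 'M[R]_(q + p) :=
  (parc t l)%:M + conj_uP (parB t) (parA t l).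

Lemma conj_uPE B A :
  conj_uP B A = block_mx (B *m A) (- (B *m A *m B)) A (- (A *m B)).
Proof. by rewrite /conj_uP mul_col_mx mul1mx mul_col_row !mulmx1 !mulmxN. Qed.

(** The inner factors cancel: [row_mx 1 (- B)] times [col_mx B 1] is [B - B]. *)
Lemma conj_uP_mul B A A' : conj_uP B A *m conj_uP B A' = 0.
Proof.
rewrite /conj_uP !mulmxA -[_ *m row_mx _ _ *m col_mx _ _]mulmxA.
by rewrite mul_row_col mul1mx mulmx1 subrr mulmx0 !mul0mx.
Qed.

Lemma par_mxC t l l' : par_mx t l *m par_mx t l' = par_mx t l' *m par_mx t l.
Proof.
rewrite /par_mx !mulmxDl !mulmxDr !conj_uP_mul !addr0.
by rewrite !mul_scalar_mx !mul_mx_scalar !scale_scalar_mx mulrC addrAC.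
Qed.

Lemma par_mx_ul t l i j : par_mx t l (lshift p i) (lshift p j) =
  parc t l *+ (i == j) + (parB t *m parA t l) i j.
Proof. by rewrite /par_mx conj_uPE mxE block_mxEul mxE. Qed.

Lemma par_mx_dl t l i j :
  par_mx t l (rshift q i) (lshift p j) = parA t l i j.
Proof. by rewrite /par_mx conj_uPE mxE block_mxEdl mxE eq_rlshift add0r. Qed.

(** Both terms on the right carry a factor [c_l], so the square vanishes with [c_l]. *)
Lemma par_mx_sqr t l : par_mx t l *m par_mx t l =
  (parc t l ^+ 2)%:M + (parc t l *: conj_uP (parB t) (parA t l)) *+ 2.
Proof.
rewrite {1}/par_mx mulmxDl mul_scalar_mx /par_mx mulmxDr conj_uP_mul addr0.
by rewrite mul_mx_scalar scalerDr scale_scalar_mx -expr2 -addrA mulr2n.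
Qed.

End Ring.

(** Applied to evaluation at [s], this turns a line of parameters over [{poly k}] into a polynomial
    curve of matrices; hence the general ring above. *)
Lemma map_par_mx (R S : comNzRingType) (f : {rmorphism R -> S}) t l :
  map_mx f (par_mx t l) = par_mx (f \o t) l.
Proof.
rewrite /par_mx /conj_uP map_mxD !map_mxM map_col_mx map_row_mx map_mxN.
rewrite !map_scalar_mx rmorph1.
by do ?congr (_ + _); do ?congr (_ *m _); do ?congr (col_mx _ _);
  do ?congr (row_mx _ _); do ?congr (- _); apply/matrixP => i j; rewrite !mxE.
Qed.

End Parametrization.

(** * The strict chain of strata inside the commuting variety *)

Section CommutingVariety.
Variables (k : closedFieldType) (q p r : nat).
Hypotheses (q_gt0 : (0 < q)%N) (le_pq : (p <= q)%N) (r_gt0 : (0 < r)%N).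

Local Notation T := (coordinate q p r).
Local Notation V := {ffun 'I_r -> 'M[k]_(q + p)}.
Implicit Types (t : T -> k) (x y : T) (v : V).

Definition par_tuple t : V := [ffun l => par_mx t l].

Lemma par_tuple_commuting t : commuting_variety k (q + p) r (par_tuple t).
Proof. by move=> i j; rewrite /lie_bracket !ffunE par_mxC subrr. Qed.

Definition base x : k :=
  if x is inr (inl (l, (i, j))) then ((l == 0 :> nat) && (i == j :> nat))%:R
  else 0.

(* The coordinates of [B] have to come first: they are read off the upper left
   block of the first matrix only as long as [A] and [c] take their base
   values there. *)
Definition coordinates : seq T :=
  map inl (enum {: 'I_q * 'I_p}) ++
  map inr (map inl (enum {: 'I_r * ('I_p * 'I_q)}) ++ map inr (enum 'I_r)).

Lemma size_coordinates : size coordinates = ((r + 1) * (p * q) + r)%N.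
Proof.
rewrite /coordinates size_cat (size_map inl) (size_map inr) size_cat
  (size_map inl) (size_map inr) -!cardE !card_prod !card_ord.
by rewrite mulnDl mul1n (mulnC q) addnA [(_ * _ + r * _)%N]addnC.
Qed.

Lemma uniq_coordinates : uniq coordinates.
Proof.
have inl_inj A B : injective (@inl A B) by move=> ? ? [].
have inr_inj A B : injective (@inr A B) by move=> ? ? [].
rewrite /coordinates cat_uniq (map_inj_uniq (inl_inj _ _)).
rewrite (map_inj_uniq (inr_inj _ _)) cat_uniq (map_inj_uniq (inl_inj _ _)).
rewrite (map_inj_uniq (inr_inj _ _)) !enum_uniq /= !andbT.
by apply/andP; split; apply/hasPn => _ /mapP[x _ ->]; apply/mapP => -[].
Qed.

(** While an entry of [B] is being freed, every entry of the [A_l] and every [c_l] is still to come,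
    hence frozen. *)
Lemma inr_in_drop i (e : 'I_q * 'I_p) z x0 : (i < size coordinates)%N ->
  nth x0 coordinates i = inl e -> inr z \in drop i coordinates.
Proof.
rewrite /coordinates; set s1 := map inl _; set s2 := map inr _ => ilt.
rewrite nth_cat drop_cat; case: ltnP => [_ _|s1i].
  rewrite mem_cat orbC mem_map; last by move=> ? ? [].
  case: z => z; rewrite mem_cat; apply/orP; left; apply/orP; [left|right];
  by rewrite mem_map ?mem_enum// => ? ? [].
have : nth x0 s2 (i - size s1) \in s2.
  by rewrite mem_nth// ltn_subLR// -size_cat.
by move=> /mapP[w _ ->].
Qed.

Definition stratum (i : nat) : set V :=
  [set par_tuple t | t in
    [set t : T -> k | forall y, y \in drop i coordinates -> t y = base y]].

Lemma stratum_neq0 i : stratum i !=set0.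
Proof. by exists (par_tuple base), base. Qed.

Lemma stratumS i : stratum i `<=` stratum i.+1.
Proof.
move=> _ [t tb <-]; exists t => // y yi; apply: tb.
by move: yi; rewrite -addn1 addnC -drop_drop => /mem_drop.
Qed.

Lemma stratum_connected i : curve_connected (stratum i).
Proof.
move=> _ _ [t tb <-] [u ub <-].
(* The segment from [t] to [u]; coordinates frozen at both ends stay frozen along it. *)
pose w x : {poly k} := (t x)%:P + (u x - t x) *: 'X.
have wE s : (fun x => t x + (u x - t x) * s) = horner_eval s \o w.
  by apply/funext => x; rewrite /= /horner_eval !hornerE.
exists (fun s => par_tuple (fun x => t x + (u x - t x) * s)); split.
- have := polynomial_curve_tuple (par_mx w); congr polynomial_curve.
  apply/funext => s; apply/ffunP => l.
  by rewrite !ffunE wE; apply: map_par_mx.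
- move=> s; exists (fun x => t x + (u x - t x) * s) => // y yi.
  by rewrite tb// ub// subrr mul0r addr0.
- by congr par_tuple; apply/funext => x; rewrite mulr0 addr0.
- by congr par_tuple; apply/funext => x; rewrite mulr1 addrC subrK.
Qed.

Let l0 : 'I_r := Ordinal r_gt0.
Let o0 : 'I_q := Ordinal q_gt0.

(** Column [j] of [B] is read at [widen_ord le_pq j] because the upper left block is then [(B 0)].
    The scalar [c_l] is read off the square, since the diagonal entries of the matrix itself mix it
    with those of [B A_l]. *)
Definition separator x v : k :=
  match x with
  | inl (i, j) =>
      tuple_entry l0 (lshift p i) (lshift p (widen_ord le_pq j)) v
  | inr (inl (l, (i, j))) =>
      tuple_entry l (rshift q i) (lshift p j) v - base x
  | inr (inr l) => (v l *m v l) (lshift p o0) (lshift p o0)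
  end.

Lemma polynomial_separator x : polynomial_function (separator x).
Proof.
case: x => [[i j]|[[l [i j]]|l]] /=.
- exact: polynomial_function_linear.
- apply: polynomial_functionD; last exact: polynomial_function_cst.
  exact: polynomial_function_linear.
have [P PE] : polynomial_function (fun v => \sum_j
    tuple_entry l (lshift p o0) j v * tuple_entry l j (lshift p o0) v).
  apply: polynomial_function_sum => j.
  by apply: polynomial_functionM; apply: polynomial_function_linear.
by exists P => v; rewrite PE /separator mxE.
Qed.

(** Here [c_0 = 0] and [A_0 = (1 0)], so the upper left block of the [0]-th matrix is
    [B A_0 = (B 0)]. *)
Lemma separator_inl t i j : (forall z, t (inr z) = base (inr z)) ->
  separator (inl (i, j)) (par_tuple t) = t (inl (i, j)).
Proof.
move=> tb; rewrite /separator /tuple_entry ffunE par_mx_ul /parc tb mul0rn.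
rewrite add0r mxE (bigD1 j)//= big1 => [|j' j'j]; rewrite !mxE tb /=.
  by rewrite !eqxx mulr1 addr0.
by rewrite (_ : (j' == j :> nat) = false) ?mulr0//; apply/negbTE.
Qed.

Lemma separator_inrl t l i j : separator (inr (inl (l, (i, j)))) (par_tuple t) =
  t (inr (inl (l, (i, j)))) - base (inr (inl (l, (i, j)))).
Proof. by rewrite /separator /tuple_entry ffunE par_mx_dl mxE. Qed.

Lemma separator_inrr0 t l :
  t (inr (inr l)) = 0 -> separator (inr (inr l)) (par_tuple t) = 0.
Proof.
move=> t0; rewrite /separator ffunE par_mx_sqr /parc t0.
by rewrite expr2 mul0r scale0r mul0rn addr0 raddf0 mxE.
Qed.

(** With [B = 0] the conjugate has zero upper left block, so the corner entry of the square is
    [c_l ^ 2], in every characteristic. *)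
Lemma separator_inrr1 t l : t (inr (inr l)) = 1 ->
  (forall e, t (inl e) = 0) -> separator (inr (inr l)) (par_tuple t) = 1.
Proof.
move=> t1 tB; rewrite /separator ffunE par_mx_sqr /parc t1.
rewrite expr1n scale1r mulr2n.
have : conj_uP (parB t) (parA t l) (lshift p o0) (lshift p o0) = 0.
  have -> : parB t = 0 by apply/matrixP => i j; rewrite !mxE tB.
  by rewrite conj_uPE mul0mx block_mxEul mxE.
by move: (conj_uP _ _) => N N0; rewrite !mxE N0 eqxx !addr0.
Qed.

Lemma stratum_separated i : (i < size coordinates)%N -> exists f : V -> k,
  [/\ polynomial_function f, forall v, stratum i v -> f v = 0 &
      exists2 v, stratum i.+1 v & f v != 0].
Proof.
move=> ilt; pose x := nth (inr (inr l0)) coordinates i.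
have dropE : drop i coordinates = x :: drop i.+1 coordinates.
  exact: drop_nth.
have xNdrop : x \notin drop i.+1 coordinates.
  by have := drop_uniq i uniq_coordinates; rewrite dropE => /andP[].
(* The witness in the next stratum moves only [x], by 1 from its base value. *)
pose u y := base y + (y == x)%:R.
have uE y : y != x -> u y = base y by rewrite /u => /negPf->; rewrite addr0.
have ux : u x = base x + 1 by rewrite /u eqxx.
exists (separator x); split; first exact: polynomial_separator.
  move=> _ [t tb <-].
  have tx : t x = base x by apply: tb; rewrite dropE mem_head.
  (* If [x] is an entry of [B], then [A] and [c] have their base values, as [separator_inl]
     requires. *)
  have xin z e : x = inl e -> inr z \in drop i coordinates.
    exact: inr_in_drop.
  case: x tx xin {dropE xNdrop u uE ux} => [[a b]|[[l [a b]]|l]] tx xin.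
  - by rewrite separator_inl// => z; apply/tb/(xin _ (a, b)).
  - by rewrite separator_inrl tx subrr.
  - exact: separator_inrr0.
exists (par_tuple u).
  by exists u => // y yi; apply: uE; apply: contraNneq xNdrop => <-.
case: x {dropE xNdrop} @u uE ux => [[a b]|[[l [a b]]|l]] u uE ux.
- by rewrite separator_inl ?ux ?add0r ?oner_neq0// => z; rewrite uE.
- by rewrite separator_inrl ux addrC addKr oner_neq0.
- by rewrite separator_inrr1 ?oner_neq0 ?ux ?add0r// => e; rewrite uE.
Qed.

Lemma le_dim_commuting_variety :
  (((((r + 1) * (p * q) + r)%N)%:Z)%:E
     <= zariski_dim (commuting_variety k (q + p) r))%E.
Proof.
rewrite -size_coordinates.
apply: (@le_zariski_dim_curve_connected _ _ _ _ stratum).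
- move=> i _; split; [exact: stratum_neq0 | | exact: stratum_connected].
  by move=> _ [t _ <-]; apply: par_tuple_commuting.
- by move=> i _; apply: stratumS.
- exact: stratum_separated.
Qed.

End CommutingVariety.

Theorem theorem4p2p1 (k : closedFieldType) (n r : nat)
    (hn : (1 <= n)%N) (hr : (2 <= r)%N) :
  ((((r + 1) * \dim (uP k n) + r)%N%:Z)%:E
     <= zariski_dim (commuting_variety k n r))%E.
Proof.
have q_gt0 : (0 < uphalf n)%N by rewrite uphalf_gt0.
have le_pq : (n./2 <= uphalf n)%N by rewrite uphalf_half leq_addl.
(* Taking [q = uphalf n] and [p = n./2] makes [p * q] the dimension of [uP k n]. *)
have := le_dim_commuting_variety k q_gt0 le_pq (ltnW hr).
by rewrite dim_uP uphalf_addn_half.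
Qed.
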